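(* Let $k$ be a field of characteristic zero, let $i \ge 2$, let $S_i = k[X, Y_1, \ldots, Y_i]/\left(X^2, (Y_1, \ldots, Y_i)^2\right)$, and let $x, y_1, \dots, y_i$ be the images of $X, Y_1, \dots, Y_i$ in $S_i$. If $T$ is a totally reflexive $S_i$-module which is minimally generated by $n$ elements, then there exists a presentation matrix of $T$ of the form $x I_n + \sum_{j=1}^i B_j y_j$, where $I_n$ is the $n\times n$ identity matrix and $B_j$ is an $n \times n$ matrix with entries in $k$ for $j=1,\dots,i$.
   Context: Here $(Y_1,\ldots,Y_i)^2$ denotes the square of the ideal $(Y_1,\dots,Y_i)$, so $S_i$ is a commutative Artinian local ring. A finitely generated module $M$ over a commutative Noetherian ring $R$ is called totally reflexive if $\operatorname{Ext}_R^j(M,R)=0$ and $\operatorname{Ext}_R^j(\operatorname{Hom}_R(M,R),R)=0$ for all $j>0$, and the biduality map $M \to \operatorname{Hom}_R(\operatorname{Hom}_R(M,R),R)$ is an isomorphism. If $F_1 \xrightarrow{\varphi} F_0 \to M \to 0$ is a minimal free presentation of a module $M$ over a local ring, then any matrix representing $\varphi$ is called a presentation matrix of $M$.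
   Formalization: The formal theorem additionally assumes that T has no direct summand isomorphic to S_i; without this the statement fails, e.g. for T = S_i, whose minimal presentation matrix is 1×0. *)

(* Defs.v *)
From HB Require Import structures.
From mathcomp Require Import all_boot all_algebra.
From mathcomp Require Import ring_quotient.
From mathcomp Require Import boolp mpoly.

Set Implicit Arguments.
Unset Strict Implicit.
Unset Printing Implicit Defensive.

Import GRing.Theory.

Local Open Scope ring_scope.
Local Open Scope quotient_scope.

Section Ideals.
Variable R : comNzRingType.

Definition ideal_gen (G : R -> Prop) (p : R) : Prop :=
  exists (m : nat) (a g : 'I_m -> R),
    (forall j, G (g j)) /\ p = \sum_(j < m) a j * g j.

Definition ideal_mul (I J : R -> Prop) : R -> Prop :=
  ideal_gen (fun p => exists a b, [/\ I a, J b & p = a * b]).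

Lemma ideal_gen_sub (G : R -> Prop) (P : R -> Prop) p :
  P 0 -> (forall a b, P a -> P b -> P (a + b)) ->
  (forall a b, P b -> P (a * b)) ->
  (forall g, G g -> P g) -> ideal_gen G p -> P p.
Proof.
move=> P0 PD PM GP [m [a [g [Gg ->]]]].
by elim/big_ind: _ => // j _; apply/PM/GP/Gg.
Qed.

Lemma ideal_gen_closed (G : R -> Prop) :
  ~ ideal_gen G 1 -> idealr_closed (fun p => `[< ideal_gen G p >]).
Proof.
move=> G1; split.
- by apply/asboolP; exists 0%N, (fun=> 0), (fun=> 0); split; [case|rewrite big_ord0].
- by apply/asboolP.
move=> a u v /asboolP[m [b [g [Gg ->]]]] /asboolP[m' [b' [g' [Gg' ->]]]].
apply/asboolP; exists (m + m')%N.
exists (fun j => match split j with inl j => a * b j | inr j => b' j end).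
exists (fun j => match split j with inl j => g j | inr j => g' j end).
split=> [j|]; first by case: (split j).
rewrite big_split_ord /= mulr_sumr; congr (_ + _); apply: eq_bigr => j _.
  by case: splitP => [j' /= /val_inj <-|j' /= jE]; rewrite ?mulrA //;
     have := ltn_ord j; rewrite jE ltnNge leq_addr.
case: splitP => [j' /= jE|j' /= /addnI/val_inj -> //].
by have := ltn_ord j'; rewrite -jE ltnNge leq_addr.
Qed.

End Ideals.

(* The polynomial ring k[X, Y_1, ..., Y_i] is {mpoly k[i.+1]}; the variable of
   index 0 is X, and those of index j + 1 are the Y's. *)
Section QuotientRing.
Variables (k : fieldType) (i : nat).
Local Notation P := {mpoly k[i.+1]}.

Definition Xpoly : P := 'X_ord0.
Definition Ypoly (j : 'I_i) : P := 'X_(lift ord0 j).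

Definition Y_ideal : P -> Prop := ideal_gen (fun p => exists j, p = Ypoly j).

Definition S_ideal : P -> Prop :=
  ideal_gen (fun p => p = Xpoly ^+ 2 \/ ideal_mul Y_ideal Y_ideal p).

Definition S_idealb : P -> bool := fun p => `[< S_ideal p >].

Lemma S_ideal_proper : ~ S_ideal 1.
Proof.
pose ev (p : P) := p.@[fun=> 0] = 0.
have ev0 : ev 0 by exact: meval0.
have evD a b : ev a -> ev b -> ev (a + b).
  by rewrite /ev mevalD => -> ->; rewrite addr0.
have evM a b : ev b -> ev (a * b) by rewrite /ev mevalM => ->; rewrite mulr0.
suff H p : S_ideal p -> ev p.
  by move/H; rewrite /ev meval1 => /eqP; rewrite oner_eq0.
apply: (ideal_gen_sub ev0 evD evM) => g [->|].
  by rewrite /ev /Xpoly expr2 mevalM mevalXU mul0r.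
apply: (ideal_gen_sub ev0 evD evM) => _ [a [b [_ Yb ->]]]; apply: (evM _ _).
apply: (ideal_gen_sub ev0 evD evM) Yb => _ [j ->].
by rewrite /ev /Ypoly mevalXU.
Qed.

HB.instance Definition _ :=
  isIdealr.Build P S_idealb (ideal_gen_closed S_ideal_proper).

Definition S_idealr : idealr P := S_idealb.

Definition Sring : comNzRingType := {ideal_quot S_idealr}.

Definition S_of (p : P) : Sring := \pi_({ideal_quot S_idealr}) p.

Definition S_const (c : k) : Sring := S_of c%:MP.
Definition S_x : Sring := S_of Xpoly.
Definition S_y (j : 'I_i) : Sring := S_of (Ypoly j).

End QuotientRing.

Section Dual.
Variables (R : comNzRingType) (M : lmodType R).

(* Hom_R(M, R) with its pointwise R-module structure. *)
Definition dual : Type := {linear M -> R^o}.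

Definition dual_fun (f : dual) : M -> R^o := GRing.Linear.sort f.
Coercion dual_fun : dual >-> Funclass.

HB.instance Definition _ := gen_eqMixin dual.
HB.instance Definition _ := gen_choiceMixin dual.

Lemma dualP (f g : dual) : (forall x, f x = g x) -> f = g.
Proof.
case: f g => [f [[fD] [fZ]]] [g [[gD] [gZ]]] fg.
have {}fg : f = g by apply/funext.
subst g.
by rewrite (Prop_irrelevance fD gD) (Prop_irrelevance fZ gZ).
Qed.

Definition dual0 : dual := GRing.null_fun _ : {linear M -> R^o}.
Definition dual_opp (f : dual) : dual :=
  GRing.opp_fun (f : {linear M -> R^o}) : {linear M -> R^o}.
Definition dual_add (f g : dual) : dual :=
  GRing.add_fun (f : {linear M -> R^o}) (g : {linear M -> R^o})
    : {linear M -> R^o}.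
Definition dual_scale (a : R) (f : dual) : dual :=
  GRing.scale_fun a (f : {linear M -> R^o}) : {linear M -> R^o}.

Let dual_addA : associative (@dual_add).
Proof. by move=> f g h; apply: dualP => x; exact: addrA. Qed.

Let dual_addC : commutative (@dual_add).
Proof. by move=> f g; apply: dualP => x; exact: addrC. Qed.

Let dual_add0 : left_id dual0 (@dual_add).
Proof. by move=> f; apply: dualP => x; exact: add0r. Qed.

Let dual_addN : left_inverse dual0 dual_opp (@dual_add).
Proof. by move=> f; apply: dualP => x; exact: addNr. Qed.

HB.instance Definition _ :=
  GRing.isZmodule.Build dual dual_addA dual_addC dual_add0 dual_addN.

Let dual_scaleA a b f : dual_scale a (dual_scale b f) = dual_scale (a * b) f.
Proof. by apply: dualP => x; exact: scalerA. Qed.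

Let dual_scale1 : left_id 1 dual_scale.
Proof. by move=> f; apply: dualP => x; exact: scale1r. Qed.

Let dual_scaleDr : right_distributive dual_scale +%R.
Proof. by move=> a f g; apply: dualP => x; exact: scalerDr. Qed.

Let dual_scaleDl f : {morph dual_scale^~ f : a b / a + b}.
Proof. by move=> a b; apply: dualP => x; exact: scalerDl. Qed.

HB.instance Definition _ :=
  GRing.Zmodule_isLmodule.Build R dual
    dual_scaleA dual_scale1 dual_scaleDr dual_scaleDl.

Lemma dual_addE (f g : dual) x : (f + g) x = f x + g x.
Proof. by []. Qed.

Lemma dual_scaleE (a : R) (f : dual) x : (a *: f) x = a * f x.
Proof. by []. Qed.

End Dual.

Section Biduality.
Variables (R : comNzRingType) (M : lmodType R).

Definition eval_at (m : M) (f : dual M) : R^o := f m.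

Let eval_at_linear (m : M) : linear (eval_at m).
Proof. by []. Qed.

HB.instance Definition _ (m : M) :=
  GRing.isLinear.Build R (dual M) R^o *:%R (eval_at m) (eval_at_linear m).

(* M -> Hom_R(Hom_R(M, R), R), m |-> (f |-> f m). *)
Definition biduality (m : M) : dual (dual M) :=
  eval_at m : {linear dual M -> R^o}.

Let biduality_linear : linear biduality.
Proof. by move=> a u v; apply: dualP => f; exact: (linearP f). Qed.

HB.instance Definition _ :=
  GRing.isLinear.Build R M (dual (dual M)) *:%R biduality biduality_linear.

End Biduality.

Section Ext.
Variable R : comNzRingType.

Definition projective (P : lmodType R) : Prop :=
  forall (A B : lmodType R) (p : {linear A -> B}) (f : {linear P -> B}),
    (forall b, exists a, p a = b) ->
    exists g : {linear P -> A}, forall x, p (g x) = f x.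

(* ... -> res_mod 2 -> res_mod 1 -> res_mod 0 -> M -> 0, where res_diff j is
   the map from degree j + 1 to degree j. *)
Record projective_resolution (M : lmodType R) := ProjectiveResolution {
  res_mod : nat -> lmodType R;
  res_diff : forall j, {linear res_mod j.+1 -> res_mod j};
  res_aug : {linear res_mod 0%N -> M};
  res_projective : forall j, projective (res_mod j);
  res_aug_surj : forall v : M, exists u, res_aug u = v;
  res_exact0 : forall u, res_aug u = 0 <-> exists w, res_diff 0%N w = u;
  res_exact : forall j u,
    res_diff j u = 0 <-> exists w, res_diff j.+1 w = u
}.

(* Ext_R^(j+1)(M, N) = 0: in Hom_R(P, N), P a projective resolution of M, every
   cocycle of degree j + 1 is a coboundary.  By the comparison theorem this
   does not depend on P. *)
Definition Ext_succ_eq0 (j : nat) (M N : lmodType R) : Prop :=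
  forall (P : projective_resolution M) (f : {linear res_mod P j.+1 -> N}),
    (forall u, f (res_diff P j.+1 u) = 0) ->
    exists g : {linear res_mod P j -> N}, forall u, f u = g (res_diff P j u).

End Ext.

Section Modules.
Variable R : comNzRingType.

Definition generates (M : lmodType R) (N : M -> Prop) (n : nat)
    (g : 'I_n -> M) : Prop :=
  forall v, N v <-> exists c : 'I_n -> R, v = \sum_(a < n) c a *: g a.

Definition minimal_generators (M : lmodType R) (N : M -> Prop) (n : nat)
    (g : 'I_n -> M) : Prop :=
  generates N g /\
  forall (p : nat) (h : 'I_p -> M), generates N h -> (n <= p)%N.

Definition finitely_generated (M : lmodType R) : Prop :=
  exists (n : nat) (g : 'I_n -> M), generates (fun=> True) g.

Definition minimally_generated (M : lmodType R) (n : nat) : Prop :=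
  exists g : 'I_n -> M, minimal_generators (fun=> True) g.

Definition totally_reflexive (M : lmodType R) : Prop :=
  [/\ finitely_generated M,
      forall j, Ext_succ_eq0 j M R^o,
      forall j, Ext_succ_eq0 j (dual M) R^o
    & bijective (@biduality R M)].

(* R is not a direct summand of M: M has no nonzero free direct summand. *)
Definition no_free_summand (M : lmodType R) : Prop :=
  ~ exists (N : lmodType R) (f : {linear (R^o * N)%type -> M}), bijective f.

(* R^m -A-> R^n -eps-> M -> 0 is a minimal free presentation, A acting on
   column vectors: eps sends the standard basis to a minimal generating family
   of M, and the columns of A are a minimal generating family of ker eps. *)
Definition presentation_matrix (M : lmodType R) (n m : nat)
    (A : 'M[R]_(n, m)) : Prop :=
  exists eps : {linear 'cV[R]_n -> M},
    minimal_generators (fun=> True) (fun a => eps (delta_mx a 0)) /\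
    minimal_generators (fun v => eps v = 0) (fun b => col b A).

End Modules.

(* Main.v *)
Require Import Defs.
From mathcomp Require Import freeg.
From HB Require Import structures.
From mathcomp Require Import all_boot all_algebra ring_quotient.
From mathcomp Require Import boolp classical_sets mpoly.

(* Let Q = k[y] inside S, so that S = Q + xQ is self-dual as a Q-module and
   Ext_S^j(T, S) = Ext_Q^j(T, Q).  Since Q has square-zero maximal ideal and
   socle of dimension i >= 2, the vanishing of Ext^2 alone forces T to be free
   over Q: a socle element z = dp of the first syzygy that is not in y times the
   syzygy yields a Q-linear map from the second syzygy to Q sending y_1 p to y_2,
   and such a map does not extend to the free cover.  If x u were not in yT for
   some u in T, a Q-linear form equal to 1 at x u would coinduce an S-linear form
   with unit value at u, splitting off a copy of S.  So xT is contained in yT,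
   minimal generators of T over S form a Q-basis of T, and x acts on this basis
   by a matrix with entries in the span of the y_j. *)

Set Implicit Arguments.
Unset Strict Implicit.
Unset Printing Implicit Defensive.

Import GRing.Theory.

Local Open Scope ring_scope.

(** * Free resolutions *)

Section FreeModules.
Variables (R : comNzRingType) (X : choiceType).

Definition free_mod : lmodType R := {freeg X / R}.
Definition free_gen (z : X) : free_mod := << z >>.
Definition free_coef (z : X) (u : free_mod) : R := coeff z u.

Lemma free_coefD z u v : free_coef z (u + v) = free_coef z u + free_coef z v.
Proof. exact: coeffD. Qed.

Lemma free_coefZ z c u : free_coef z (c *: u) = c * free_coef z u.
Proof. exact: coeffZ. Qed.

Lemma free_sumE (u : free_mod) :
  u = \sum_(z <- dom u) free_coef z u *: free_gen z.
Proof.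
rewrite -[LHS]freeg_sumE; apply: eq_bigr => z _.
by apply/eqP/freeg_eqP => t; rewrite coeffZ !coeffU mul1r.
Qed.

Section Lift.
Variables (M : lmodType R) (f : X -> M).

Let lift (u : free_mod) : M := fglift f u.

Let lift_linear : linear lift.
Proof.
have fB : zmod_morphism lift := lift_is_additive f.
pose fA := GRing.isZmodMorphism.Build free_mod M lift fB.
pose g : {additive free_mod -> M} := HB.pack lift fA.
have lift_sum r (E : X -> free_mod) : lift (\sum_(z <- r) E z) = \sum_(z <- r) lift (E z).
  by rewrite -[lift _]/(g _) raddf_sum.
have liftZ c u : lift (c *: u) = c *: lift u.
  rewrite -{2}(freeg_sumE u) [RHS](congr1 _ (lift_sum _ _)) scaler_sumr.
  rewrite [LHS]lift_sum; apply: eq_bigr => z _.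
  by rewrite /lift !liftU scalerA.
by move=> c u v; rewrite -liftZ -![lift _]/(g _) raddfD.
Qed.

HB.instance Definition _ :=
  GRing.isLinear.Build R free_mod M *:%R lift lift_linear.

Definition free_lift : {linear free_mod -> M} := lift.

Lemma free_liftE z : free_lift (free_gen z) = f z.
Proof. by rewrite /free_lift /= /lift liftU scale1r. Qed.

End Lift.

Lemma free_linear_ext (M : lmodType R) (f g : {linear free_mod -> M}) :
  (forall z, f (free_gen z) = g (free_gen z)) -> f =1 g.
Proof.
move=> fg u; rewrite (free_sumE u) !linear_sum; apply: eq_bigr => z _.
by rewrite !linearZ /= fg.
Qed.

Lemma free_projective : projective free_mod.
Proof.
move=> A B p f p_surj.
have [g gE] := choice (fun z : X => p_surj (f (free_gen z))).
exists (free_lift g); apply: (@free_linear_ext B (p \o free_lift g)%FUN f) => z.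
by rewrite [LHS]/= free_liftE gE.
Qed.

End FreeModules.

Section FreeResolution.
Variables (R : comNzRingType) (M : lmodType R).

(** Bundling a map with its domain and codomain turns the dependent recursion behind the resolution
    into a plain [iter]. *)
Record arrow := Arrow {
  arrow_dom : lmodType R;
  arrow_cod : lmodType R;
  arrow_map : {linear arrow_dom -> arrow_cod}
}.

(* The free module on the elements of the kernel covers it; this avoids making
   the kernel a module. *)
Definition ker_set (A B : lmodType R) (d : {linear A -> B}) :=
  {u : A | d u == 0}.

Definition cover_ker (a : arrow) : arrow :=
  Arrow (free_lift (val : ker_set (arrow_map a) -> arrow_dom a)).

Definition free_cover : arrow := Arrow (free_lift (id : M -> M)).

(** Stage 0 is the augmentation, so the differential of index j is stage j + 1. *)
Definition free_res_arrow (j : nat) : arrow := iter j cover_ker free_cover.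

Definition free_res_mod (j : nat) : lmodType R := arrow_dom (free_res_arrow j).

Definition free_res_diff (j : nat) :
  {linear free_res_mod j.+1 -> free_res_mod j} := arrow_map (free_res_arrow j.+1).

Lemma cover_ker_exact (a : arrow) u :
  arrow_map a u = 0 <-> exists w, arrow_map (cover_ker a) w = u.
Proof.
split=> [/eqP u0|[w <-]].
  by exists << (exist _ u u0 : ker_set (arrow_map a)) >>; apply: free_liftE.
pose d := free_lift (val : ker_set (arrow_map a) -> arrow_dom a).
apply: (@free_linear_ext _ _ _ (arrow_map a \o d)%FUN \0 _ w) => z.
by rewrite /= /d free_liftE; apply/eqP/(valP z).
Qed.

(** Since [Ext_succ_eq0] quantifies over all projective resolutions, it may be tested on this one.
    The definition is transparent so that its terms are seen to be free modules. *)
Definition free_resolution : projective_resolution M.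
Proof.
refine (@ProjectiveResolution R M free_res_mod free_res_diff
  (arrow_map free_cover) _ _ _ _).
- by case=> [|j]; apply: free_projective.
- by move=> v; exists (free_gen R v); apply: free_liftE.
- exact: (@cover_ker_exact free_cover).
- by move=> j; apply: (@cover_ker_exact (free_res_arrow j.+1)).
Defined.

End FreeResolution.

(** * Linear forms on vector spaces *)

Section Separation.
Variables (k : fieldType) (V : lmodType k).

Definition subspace (U : set V) : Prop :=
  U 0 /\ forall c a b, U a -> U b -> U (c *: a + b).

Lemma subspaceZ (U : set V) c a : subspace U -> U a -> U (c *: a).
Proof. by move=> [U0 UL] Ua; rewrite -[c *: a]addr0; apply: UL. Qed.

Lemma subspaceB (U : set V) a b : subspace U -> U a -> U b -> U (a - b).
Proof. by move=> [U0 UL] Ua Ub; rewrite addrC -scaleN1r; apply: UL. Qed.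

Lemma maximal_avoiding_subspace (W : set V) v : subspace W -> ~ W v ->
  exists U, [/\ subspace U, ~ U v, (W `<=` U)%classic &
    forall U', subspace U' -> (U `<=` U')%classic -> ~ U' v -> (U' `<=` U)%classic].
Proof.
move=> sW Wv.
(* Zorn is applied to the sets A whose union with W is a subspace avoiding v, so that the empty
   chain, with empty union, is covered by W itself. *)
pose P := [set A : set V | subspace (W `|` A)%classic /\ ~ (W `|` A)%classic v]%classic.
have [|A [[sA Av] maxA]] := @Zorn_bigcup V P.
  move=> F FP chF; split; last by case=> // -[X /FP[_ Xv] vX]; apply: Xv; right.
  split=> [|c a b]; first by left; case: sW.
  have step X a' b' : F X -> (W `|` X)%classic a' -> (W `|` X)%classic b' ->
      (W `|` \bigcup_(X in F) X)%classic (c *: a' + b').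
    move=> FX aX bX; have [[_ sX] _] := FP _ FX.
    by case: (sX c _ _ aX bX) => [?|?]; [left|right; exists X].
  case=> [Wa|[X FX Xa]] [Wb|[Y FY Yb]].
  - by left; case: sW => _; apply.
  - exact: (step Y _ _ FY (or_introl Wa) (or_intror Yb)).
  - exact: (step X _ _ FX (or_intror Xa) (or_introl Wb)).
  case: (chF _ _ FX FY) => [XY|YX].
    exact: (step Y _ _ FY (or_intror (XY _ Xa)) (or_intror Yb)).
  exact: (step X _ _ FX (or_intror Xa) (or_intror (YX _ Yb))).
exists (W `|` A)%classic; split=> // U' sU' AU' U'v u U'u.
have WU' : (W `|` U' = U')%classic.
  by apply/seteqP; split=> [a [Wa|]|a] //; [apply: AU'; left|right].
have [AU|AU] := pselect (U' `<=` A)%classic; first by right; exact: (AU _ U'u).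
have AltU' : (A `<` U')%classic by split=> // a Aa; apply: AU'; right.
by case: (maxA _ AltU'); split; rewrite WU'.
Qed.

(** A subspace U maximal among those that contain W and avoid v is a complement of the line of v;
    the form sends u to the scalar c with u - c v in U. *)
Lemma separating_functional (W : set V) v : subspace W -> ~ W v ->
  exists l : {linear V -> k^o}, l v = 1 /\ forall w, W w -> l w = 0.
Proof.
move=> sW Wv.
have [U [sU Uv WU maxU]] := maximal_avoiding_subspace sW Wv.
have coef u : exists c, U (u - c *: v).
  have [Uu|Uu] := pselect (U u); first by exists 0; rewrite scale0r subr0.
  (* This is U + k u. If it contains v, the relation can be solved for u modulo U; otherwise
     maximality puts u in U. *)
  pose U' := [set w | exists c, U (w - c *: u)]%classic.
  have [[c Uc]|U'v] := pselect (U' v).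
    have [c0|c0] := eqVneq c 0; first by move: Uc; rewrite c0 scale0r subr0.
    exists c^-1; rewrite -[u - _]opprK opprB -scaleN1r; apply: subspaceZ => //.
    have -> : c^-1 *: v - u = c^-1 *: (v - c *: u).
      by rewrite scalerBr scalerA mulVf // scale1r.
    exact: subspaceZ.
  case: Uu; apply: (maxU U') => //.
  - split=> [|c a b [ca Ua] [cb Ub]].
      by exists 0; rewrite scale0r subr0; case: sU.
    exists (c * ca + cb); have -> : c *: a + b - (c * ca + cb) *: u =
      c *: (a - ca *: u) + (b - cb *: u).
      by rewrite scalerBr scalerA scalerDl opprD addrACA.
    by case: sU => _; apply.
  - by move=> a Ua; exists 0; rewrite scale0r subr0.
  by exists 1; rewrite scale1r subrr; case: sU.
have coef_uniq u c c' : U (u - c *: v) -> U (u - c' *: v) -> c = c'.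
  move=> Uc Uc'; have [//|] := eqVneq c c'; rewrite -subr_eq0 => cc'.
  case: Uv; rewrite -[v]scale1r -(mulVf cc') -scalerA; apply: subspaceZ => //.
  rewrite scalerBl; have -> : c *: v - c' *: v = (u - c' *: v) - (u - c *: v).
    by rewrite opprB [RHS]addrC addrA subrK.
  exact: subspaceB.
have [l lP] := choice coef.
have l_linear : linear (l : V -> k^o).
  move=> c a b; apply: (coef_uniq (c *: a + b)) => //.
  have -> : c *: a + b - (c *: (l a : k^o) + l b) *: v =
      c *: (a - l a *: v) + (b - l b *: v).
    by rewrite scalerBr scalerA scalerDl opprD addrACA.
  by case: sU => _; apply.
pose lL := GRing.isLinear.Build k V k^o *:%R l l_linear.
exists (HB.pack l lL : {linear V -> k^o}); split=> [|w Ww] /=.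
  by apply: (coef_uniq v) => //; rewrite scale1r subrr; case: sU.
by apply: (coef_uniq w) => //; rewrite scale0r subr0; apply: WU.
Qed.

End Separation.

(** An alias of V, so that the action of k through f does not clash with the action of R. *)
Definition restrict_scalars (k : fieldType) (R : nzRingType)
  (f : {rmorphism k -> R}) (V : lmodType R) : Type := V.

Section RestrictScalars.
Variables (k : fieldType) (R : nzRingType) (f : {rmorphism k -> R}) (V : lmodType R).
Local Notation Vk := (restrict_scalars f V).

HB.instance Definition _ := GRing.Zmodule.copy Vk V.

Let restrict_scale (c : k) (v : Vk) : Vk := f c *: (v : V).

Let restrict_scaleA a b v :
  restrict_scale a (restrict_scale b v) = restrict_scale (a * b) v.
Proof. by rewrite /restrict_scale scalerA rmorphM. Qed.

Let restrict_scale1 : left_id 1 restrict_scale.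
Proof. by move=> v; rewrite /restrict_scale rmorph1 scale1r. Qed.

Let restrict_scaleDr : right_distributive restrict_scale +%R.
Proof. by move=> a u v; apply: scalerDr. Qed.

Let restrict_scaleDl v : {morph restrict_scale^~ v : a b / a + b}.
Proof. by move=> a b; rewrite /restrict_scale rmorphD scalerDl. Qed.

HB.instance Definition _ :=
  GRing.Zmodule_isLmodule.Build k Vk
    restrict_scaleA restrict_scale1 restrict_scaleDr restrict_scaleDl.

End RestrictScalars.

(** * The ring S *)

Section RingS.
Variables (k : fieldType) (i : nat).
Local Notation S := (Sring k i).
Local Notation cst := (@S_const k i).
Local Notation x := (S_x k i).
Local Notation y := (@S_y k i).

Lemma S_ofD p q : S_of (p + q) = S_of p + S_of q :> S.
Proof. exact: (rmorphD (\pi_{ideal_quot (@S_idealr k i)})%qT). Qed.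

Lemma S_ofB p q : S_of (p - q) = S_of p - S_of q :> S.
Proof. exact: (rmorphB (\pi_{ideal_quot (@S_idealr k i)})%qT). Qed.

Lemma S_ofM p q : S_of (p * q) = S_of p * S_of q :> S.
Proof. exact: (rmorphM (\pi_{ideal_quot (@S_idealr k i)})%qT). Qed.

Lemma S_of1 : S_of 1 = 1 :> S.
Proof. exact: (rmorph1 (\pi_{ideal_quot (@S_idealr k i)})%qT). Qed.

Lemma S_of_eq0 (p : {mpoly k[i.+1]}) : S_of p = 0 :> S <-> S_ideal p.
Proof.
have <- : S_of 0 = 0 :> S by exact: (rmorph0 (\pi_{ideal_quot (@S_idealr k i)})%qT).
rewrite -[p in S_ideal p]subr0; split=> [/eqP|H].
  by rewrite -Quotient.idealrBE => /asboolP.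
by apply/eqP; rewrite -Quotient.idealrBE; apply/asboolP.
Qed.

(** A representative is a combination of monomials, so the constants, x and the y_j generate S as a
    ring. *)
Lemma S_ind (P : S -> Prop) :
  (forall c, P (cst c)) -> P x -> (forall j, P (y j)) ->
  (forall s t, P s -> P t -> P (s + t)) -> (forall s t, P s -> P t -> P (s * t)) ->
  forall s, P s.
Proof.
move=> Pc Px Py PD PM s; have -> : s = S_of (repr s) by rewrite /S_of reprK.
move: (repr s) => p.
have PX m : P (S_of 'X_[m]).
  rewrite mpolyXE_id; elim/big_rec: _ => [|j q _ Pq].
    by rewrite -mpolyC1; apply: Pc.
  rewrite S_ofM; apply: (PM _ _) => //; elim: (m j) => [|e IH].
    by rewrite expr0 -mpolyC1; apply: Pc.
  rewrite exprS S_ofM; apply: (PM _ _) => //.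
  by case: (unliftP ord0 j) => [j' ->|->]; [apply: Py|apply: Px].
elim/mpolyind: p => [|c m p _ _ Pp]; first by rewrite -mpolyC0; apply: Pc.
by rewrite S_ofD -mul_mpolyC S_ofM; apply: PD => //; apply: (PM _ _) => //; apply: Pc.
Qed.

Lemma S_const_is_zmod_morphism : zmod_morphism cst.
Proof. by move=> a b; rewrite /S_const mpolyCB S_ofB. Qed.

Lemma S_const_is_monoid_morphism : monoid_morphism cst.
Proof. by split=> [|a b]; rewrite /S_const ?mpolyC1 ?S_of1 // mpolyCM S_ofM. Qed.

HB.instance Definition _ :=
  GRing.isZmodMorphism.Build k S cst S_const_is_zmod_morphism.
HB.instance Definition _ :=
  GRing.isMonoidMorphism.Build k S cst S_const_is_monoid_morphism.

Lemma ideal_gen_mem (R : comNzRingType) (G : R -> Prop) g : G g -> ideal_gen G g.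
Proof. by exists 1, (fun=> 1), (fun=> g); rewrite big_ord1 mul1r. Qed.

Lemma S_xx : x * x = 0.
Proof. by rewrite -S_ofM; apply/S_of_eq0/ideal_gen_mem; left; rewrite expr2. Qed.

Lemma S_yy j l : y j * y l = 0.
Proof.
rewrite -S_ofM; apply/S_of_eq0/ideal_gen_mem; right; apply/ideal_gen_mem.
by exists (Ypoly k j), (Ypoly k l); split=> //; apply/ideal_gen_mem; eexists.
Qed.

(** The general element of Q = k[y]: all products y_j y_l vanish, so degree one in y suffices. *)
Definition qelt (c : k) (d : 'I_i -> k) : S := cst c + \sum_j cst (d j) * y j.

Lemma qeltD a b u v : qelt (a + b) (fun j => u j + v j) = qelt a u + qelt b v.
Proof.
rewrite /qelt rmorphD /= addrACA -big_split; congr (_ + _).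
by apply: eq_bigr => j _; rewrite rmorphD mulrDl.
Qed.

Lemma qeltB a b u v : qelt (a - b) (fun j => u j - v j) = qelt a u - qelt b v.
Proof.
apply/esym/eqP; rewrite subr_eq -qeltD subrK; apply/eqP; congr qelt.
by apply/funext => j; rewrite subrK.
Qed.

Lemma qeltM a b u v :
  qelt a u * qelt b v = qelt (a * b) (fun j => a * v j + b * u j).
Proof.
rewrite /qelt mulrDl !mulrDr rmorphM /= -addrA; congr (_ + _).
rewrite [X in _ + (_ + X)](_ : _ = 0) ?addr0; last first.
  rewrite mulr_suml big1 // => j _; rewrite mulr_sumr big1 // => l _.
  by rewrite mulrACA S_yy mulr0.
rewrite mulr_sumr mulr_suml -big_split; apply: eq_bigr => j _ /=.
by rewrite rmorphD !rmorphM mulrDl mulrA; congr (_ + _); rewrite mulrC mulrA.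
Qed.

Lemma S_xmul a b a' b' :
  (a + x * b) * (a' + x * b') = a * a' + x * (a * b' + b * a').
Proof.
rewrite mulrDl !mulrDr [X in _ + (_ + X)]mulrACA S_xx mul0r addr0 -addrA.
by rewrite [a * (x * b')]mulrCA -[x * b * a']mulrA.
Qed.

Lemma S_decomp s : exists c d c' d', s = qelt c d + x * qelt c' d'.
Proof.
have y0 : \sum_j cst 0 * y j = 0 by apply: big1 => j _; rewrite rmorph0 mul0r.
elim/S_ind: s.
- move=> c; exists c, (fun=> 0), 0, (fun=> 0).
  by rewrite /qelt y0 rmorph0 !addr0 mulr0 addr0.
- exists 0, (fun=> 0), 1, (fun=> 0).
  by rewrite /qelt y0 rmorph0 rmorph1 !addr0 mulr1 add0r.
- move=> j; exists 0, (fun l => (l == j)%:R), 0, (fun=> 0).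
  rewrite /qelt y0 rmorph0 !addr0 mulr0 addr0 add0r (bigD1 j) //= eqxx rmorph1 mul1r.
  by rewrite big1 ?addr0 // => l /negPf ->; rewrite rmorph0 mul0r.
- move=> _ _ [c [d [c' [d' ->]]]] [e [f [e' [f' ->]]]].
  exists (c + e), (fun j => d j + f j), (c' + e'), (fun j => d' j + f' j).
  by rewrite !qeltD [x * (_ + qelt _ _)]mulrDr addrACA.
move=> _ _ [c [d [c' [d' ->]]]] [e [f [e' [f' ->]]]].
by do 4 eexists; rewrite S_xmul !qeltM -qeltD.
Qed.

(** * Coefficients of members of the ideal, and the k-basis 1, y_j, x, x y_j of S *)

Let ydeg (m : 'X_{1..i.+1}) := (\sum_(j < i) m (lift ord0 j))%N.

Let ydegD m1 m2 : ydeg (m1 + m2)%MM = (ydeg m1 + ydeg m2)%N.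
Proof. by rewrite /ydeg -big_split /=; apply: eq_bigr => j _; rewrite mnmDE. Qed.

Lemma Y_ideal_mcoeff (p : {mpoly k[i.+1]}) m : Y_ideal p -> ydeg m = 0%N -> p@_m = 0.
Proof.
pose P (p : {mpoly k[i.+1]}) := forall m, ydeg m = 0%N -> p@_m = 0.
suff H q : Y_ideal q -> P q by move=> /H; apply.
apply: (@ideal_gen_sub _ _ P).
- by move=> {}m _; rewrite mcoeff0.
- by move=> a b Pa Pb {}m m0; rewrite mcoeffD Pa // Pb // addr0.
- move=> a b Pb {}m m0; rewrite mcoeffM big1 // => -[m1 m2] /= /eqP mE.
  rewrite Pb ?mulr0 //; move/(congr1 ydeg): mE; rewrite m0 ydegD => /esym/eqP.
  by rewrite addn_eq0 => /andP[_ /eqP].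
move=> _ [j ->] {}m /eqP m0; rewrite /Ypoly mcoeffX; case: eqP => // mE; move: m0.
by rewrite /ydeg (bigD1 j) //= -mE mnm1E eqxx.
Qed.

(** The monomials of degree at most one in X and total degree at most one in the Y's are closed
    under divisors. Vanishing of their coefficients therefore passes to multiples, and only the
    generators have to be checked. *)
Lemma S_ideal_mcoeff (p : {mpoly k[i.+1]}) (m : 'X_{1..i.+1}) :
  S_ideal p -> (m ord0 <= 1)%N -> (ydeg m <= 1)%N -> p@_m = 0.
Proof.
pose P (p : {mpoly k[i.+1]}) :=
  forall m : 'X_{1..i.+1}, (m ord0 <= 1)%N -> (ydeg m <= 1)%N -> p@_m = 0.
have P0 : P 0 by move=> {}m _ _; rewrite mcoeff0.
have PD a b : P a -> P b -> P (a + b).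
  by move=> Pa Pb {}m m0 m1; rewrite mcoeffD Pa // Pb // addr0.
have PM a b : P b -> P (a * b).
  move=> Pb {}m m0 m1; rewrite mcoeffM big1 // => -[m2 m3] /= /eqP mE.
  move: (congr1 ydeg mE) (congr1 (fun m : 'X_{1..i.+1} => m ord0) mE).
  rewrite ydegD mnmDE => m1E m0E; move: m0 m1; rewrite m0E m1E => m0 m1.
  rewrite Pb ?mulr0 //; [apply: leq_trans m0|apply: leq_trans m1]; exact: leq_addl.
suff H q : S_ideal q -> P q by move=> /H; apply.
apply: (ideal_gen_sub P0 PD PM) => g [->|].
  move=> {}m m0 _; rewrite /Xpoly expr2 -mpolyXD mcoeffX; case: eqP => // mE.
  by move: m0; rewrite -mE mnmDE mnm1E.
apply: (ideal_gen_sub P0 PD PM) => _ [a [b [Ya Yb ->]]] {}m _ m1.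
rewrite mcoeffM big1 // => -[m2 m3] /= /eqP/(congr1 ydeg) mE; move: m1; rewrite mE ydegD.
case m2E : (ydeg m2) => [|e]; first by rewrite Y_ideal_mcoeff ?mul0r.
rewrite addSn ltnS leqn0 addn_eq0 => /andP[_ /eqP m3E].
by rewrite [b@__]Y_ideal_mcoeff ?mulr0.
Qed.

(** After lifting to polynomials, each coefficient is read off at one of the monomials 1, Y_j, X, X
    Y_j, where members of the ideal have coefficient zero. *)
Lemma qelt_inj0 c d c' d' : qelt c d + x * qelt c' d' = 0 ->
  [/\ c = 0, forall j, d j = 0, c' = 0 & forall j, d' j = 0].
Proof.
pose q c d : {mpoly k[i.+1]} := c%:MP + \sum_j (d j) *: Ypoly k j.
have qE a u : qelt a u = S_of (q a u).
  rewrite /q S_ofD /qelt; congr (_ + _).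
  elim/big_rec2: _ => [|j p p' _ ->]; first by rewrite -/(cst 0) rmorph0.
  by rewrite S_ofD -mul_mpolyC S_ofM.
rewrite !qE -S_ofM -S_ofD => /S_of_eq0 H.
have qc a u m : (q a u)@_m =
  a * (m == 0%MM)%:R + \sum_j u j * (U_(lift ord0 j)%MM == m)%:R.
  rewrite mcoeffD mcoeffC linear_sum /=; congr (_ + _).
  by apply: eq_bigr => j _; rewrite mcoeffZ mcoeffX.
have Xq p m : (Xpoly k i * p)@_(U_(ord0) + m)%MM = p@_m by rewrite mulrC /Xpoly mcoeffMX.
have Xq0 p (m : 'X_{1..i.+1}) : m ord0 = 0%N -> (Xpoly k i * p)@_m = 0.
  move=> m0; rewrite mcoeffM big1 // => -[m1 m2] /= /eqP mE.
  rewrite mcoeffX; case: eqP => [m1E|_]; last by rewrite mul0r.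
  by move/(congr1 (fun m : 'X_{1..i.+1} => m ord0)): mE; rewrite m0 mnmDE -m1E mnm1E.
have yd0 : ydeg 0%MM = 0%N by rewrite /ydeg big1 // => j _; rewrite mnm0E.
have yd1 j : ydeg U_(lift ord0 j)%MM = 1%N.
  rewrite /ydeg (bigD1 j) //= mnm1E eqxx big1 // => l lj.
  by rewrite mnm1E (inj_eq lift_inj) eq_sym (negPf lj).
have yd2 m : ydeg (U_(ord0) + m)%MM = ydeg m.
  by apply: eq_bigr => j _; rewrite mnmDE mnm1E.
have q0 a u : (q a u)@_0%MM = a.
  rewrite qc eqxx mulr1 big1 ?addr0 // => j _.
  by rewrite -mdeg_eq0 mdeg1 mulr0.
have q1 a u j : (q a u)@_(U_(lift ord0 j))%MM = u j.
  rewrite qc -mdeg_eq0 mdeg1 mulr0 add0r (bigD1 j) //= eqxx mulr1 big1 ?addr0 // => l lj.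
  by rewrite eq_mnm1 (inj_eq lift_inj) (negPf lj) mulr0.
split=> [|j||j].
- move: (S_ideal_mcoeff (m := 0%MM) H); rewrite mnm0E yd0 => /(_ isT isT).
  by rewrite mcoeffD q0 Xq0 ?mnm0E // addr0.
- move: (S_ideal_mcoeff (m := U_(lift ord0 j)%MM) H); rewrite mnm1E yd1 => /(_ isT isT).
  by rewrite mcoeffD q1 Xq0 ?mnm1E // addr0.
(* The monomial X is written as a sum with 0 so that [Xq] applies. *)
- move: (S_ideal_mcoeff (m := (U_(ord0) + 0)%MM) H).
  rewrite mnmDE mnm0E mnm1E eqxx yd2 yd0 => /(_ isT isT).
  rewrite mcoeffD Xq q0 qc big1 => [|l _]; last first.
    by rewrite addm0 eq_mnm1 -(inj_eq val_inj) mulr0.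
  by rewrite -mdeg_eq0 addm0 mdeg1 mulr0 !add0r.
move: (S_ideal_mcoeff (m := (U_(ord0) + U_(lift ord0 j))%MM) H).
rewrite mnmDE !mnm1E eqxx yd2 yd1 => /(_ isT isT).
rewrite mcoeffD Xq q1 qc big1 => [|l _]; last first.
  case: eqP => [/(congr1 (fun m : 'X_{1..i.+1} => m ord0))|_]; last by rewrite mulr0.
  by rewrite mnmDE !mnm1E eqxx.
by rewrite -mdeg_eq0 mdegD !mdeg1 mulr0 !add0r.
Qed.

End RingS.

(** * Modules over S *)

Section ModulesOverS.
Variables (k : fieldType) (i : nat).
Local Notation S := (Sring k i).
Local Notation cst := (@S_const k i).
Local Notation x := (S_x k i).
Local Notation y := (@S_y k i).

Lemma S_y_mul j c d c' d' :
  y j * (qelt c d + x * qelt c' d') = cst c * y j + x * (cst c' * y j).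
Proof.
have yq a (u : 'I_i -> k) : y j * qelt a u = cst a * y j.
  rewrite /qelt mulrDr mulr_sumr big1 ?addr0 1?mulrC // => l _.
  by rewrite mulrCA S_yy mulr0.
by rewrite mulrDr mulrCA !yq.
Qed.

Lemma qelt0 (d : 'I_i -> k) : qelt 0 d = \sum_j cst (d j) * y j.
Proof. by rewrite /qelt rmorph0 add0r. Qed.

Lemma S_yspan_sqr (s : 'I_i -> S) : (\sum_j y j * s j) * (\sum_j y j * s j) = 0.
Proof.
rewrite mulr_suml big1 // => j _; rewrite mulr_sumr big1 // => l _.
by rewrite mulrACA S_yy mul0r.
Qed.

(** A multiple of y_j is a combination of y_j and x y_j alone, whereas the left side has coefficient
    1 at x y_l. *)
Lemma S_xy_indep j l (a : k) s : l != j ->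
  cst a * y l + x * y l = y j * s -> False.
Proof.
move=> lj; have [c [d [c' [d' ->]]]] := S_decomp s.
rewrite S_y_mul => /eqP; rewrite -subr_eq0 => /eqP E.
have dl u (b : k) : cst b * y u = \sum_v cst (b *+ (v == u)) * y v.
  rewrite (bigD1 u) //= eqxx big1 ?addr0 // => v /negPf ->.
  by rewrite mulr0n rmorph0 mul0r.
have [|_ _ _ /(_ l)] := @qelt_inj0 k i 0 (fun v => a *+ (v == l) - c *+ (v == j))
    0 (fun v => 1 *+ (v == l) - c' *+ (v == j)).
  rewrite -[RHS]E !qelt0 -[y l in X in _ + X - _]mul1r -(rmorph1 cst) !dl.
  do 2 under [\sum_v cst (_ - _) * y v]eq_bigr do rewrite rmorphB mulrBl.
  by rewrite !sumrB mulrBr opprD addrACA.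
by rewrite eqxx (negPf lj) mulr0n subr0 => /eqP; rewrite oner_eq0.
Qed.

(** This is the residue map of the local ring S, well defined because the decomposition is unique;
    it reduces matrices over S to matrices over k. *)
Lemma S_augmentation : exists e : {rmorphism S -> k},
  forall c d c' d', e (qelt c d + x * qelt c' d') = c.
Proof.
have [e eP] := choice (@S_decomp k i).
have eE c d c' d' : e (qelt c d + x * qelt c' d') = c.
  set s := _ + _; have [u [v [w sE]]] := eP s.
  have [|/eqP + _ _ _] := @qelt_inj0 k i (e s - c) (fun j => u j - d j)
    (v - c') (fun j => w j - d' j); last by rewrite subr_eq0 => /eqP.
  by rewrite !qeltB mulrBr addrACA -opprD -sE subrr.
have e_sub : zmod_morphism e.
  suff eD a b : e (a + b) = e a + e b.
    by move=> a b; apply/eqP; rewrite eq_sym subr_eq -eD subrK.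
  have [c [d [c' [d' ->]]]] := S_decomp a; have [f [g [f' [g' ->]]]] := S_decomp b.
  by rewrite addrACA -[x * _ + x * _]mulrDr -!qeltD !eE.
have e_mul : monoid_morphism e.
  split=> [|a b].
    rewrite (_ : 1 = qelt 1 (fun=> 0) + x * qelt 0 (fun=> 0) :> S) ?eE //.
    by rewrite /qelt rmorph1 rmorph0 big1 ?addr0 ?mulr0 ?addr0 // => j _; rewrite mul0r.
  have [c [d [c' [d' ->]]]] := S_decomp a; have [f [g [f' [g' ->]]]] := S_decomp b.
  rewrite S_xmul !qeltM -qeltD !eE //.
pose eZ := GRing.isZmodMorphism.Build S k e e_sub.
pose eM := GRing.isMonoidMorphism.Build S k e e_mul.
by exists (HB.pack e eZ eM : {rmorphism S -> k}).
Qed.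

Definition in_yM (V : lmodType S) (v : V) : Prop :=
  exists w : 'I_i -> V, v = \sum_j y j *: w j.

(* Freeness over the subalgebra k[y_1, ..., y_i]. *)
Definition y_free (V : lmodType S) : Prop :=
  forall t : 'I_i -> V, \sum_j y j *: t j = 0 -> forall j, in_yM (t j).

(** The relation kills the constant term and the coefficient of x in each t_j; what remains of t_j
    lies in the ideal of the y's. *)
Lemma y_free_S : y_free S^o.
Proof.
move=> t.
have [c /choice[d /choice[c' /choice[d' tE]]]] := choice (fun j => S_decomp (t j)).
move=> t0; have [|_ c0 _ c'0] := @qelt_inj0 k i 0 c 0 c'.
  rewrite -[RHS]t0 !qelt0 mulr_sumr -big_split; apply: eq_bigr => j _.
  by rewrite /= tE; rewrite [RHS]S_y_mul.
move=> j; exists (fun l => cst (d j l) + x * cst (d' j l)).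
rewrite tE c0 c'0 !qelt0 mulr_sumr -big_split; apply: eq_bigr => l _ /=.
by rewrite [RHS]mulrC mulrDl mulrA.
Qed.

Lemma y_free_free_mod (X : choiceType) : y_free (free_mod S X).
Proof.
move=> t t0 j.
have coef0 z l : in_yM (free_coef z (t l) : S^o).
  apply: (@y_free_S (fun l => free_coef z (t l))).
  have f0 : free_coef z (0 : free_mod S X) = 0 by apply: coeff0.
  rewrite -[RHS]f0 -t0 (big_morph (free_coef z) (free_coefD z) f0).
  by apply: eq_bigr => a _; rewrite free_coefZ.
have [c cE] := choice (coef0^~ j).
exists (fun l => \sum_(z <- dom (t j)) c z l *: free_gen S z).
rewrite {1}(free_sumE (t j)).
under [RHS]eq_bigr do rewrite scaler_sumr.
rewrite exchange_big; apply: eq_bigr => z _ /=.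
rewrite {1}cE scaler_suml; apply: eq_bigr => l _.
by rewrite scalerA.
Qed.

Definition k_linear (V : lmodType S) (l : V -> k) : Prop :=
  (forall a b, l (a + b) = l a + l b) /\ forall c a, l (cst c *: a) = c * l a.

Lemma k_linear0 (V : lmodType S) (l : V -> k) : k_linear l -> l 0 = 0.
Proof. by move=> [_ lZ]; rewrite -(scale0r (0 : V)) -(rmorph0 cst) lZ mul0r. Qed.

Lemma k_separation (V : lmodType S) (W : set V) v :
  W 0 -> (forall a b, W a -> W b -> W (a + b)) ->
  (forall c a, W a -> W (cst c *: a)) -> ~ W v ->
  exists l : V -> k, [/\ k_linear l, l v = 1 & forall w, W w -> l w = 0].
Proof.
move=> W0 WD WZ Wv.
have sW : @subspace k (restrict_scalars cst V) W.
  by split=> // c a b Wa Wb; apply: WD => //; apply: WZ.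
have [l [lv lW]] := separating_functional sW Wv.
exists l; split=> //; split=> [a b|c a]; first exact: (raddfD l).
by rewrite -[RHS](linearZ_LR l).
Qed.

(* A form on V x k that kills the graph G and is 1 at (0, 1) restricts to the
   opposite of the required form on V. *)
Lemma k_extension (V : lmodType S) (G : V -> k -> Prop) :
  G 0 0 -> (forall a b c d, G a c -> G b d -> G (a + b) (c + d)) ->
  (forall e a c, G a c -> G (cst e *: a) (e * c)) ->
  (forall c, G 0 c -> c = 0) ->
  exists2 l : V -> k, k_linear l & forall v c, G v c -> l v = c.
Proof.
move=> G0 GD GZ Gf.
pose VK : lmodType k := (restrict_scalars cst V * k^o)%type.
have sG : @subspace k VK (fun vc => G vc.1 vc.2).
  by split=> // c a b Ga Gb; apply: GD => //; apply: GZ.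
have [|l [l1 lG]] := @separating_functional k VK _ (0, 1) sG.
  by move=> /Gf /eqP; rewrite oner_eq0.
have lZ c w : l (c *: w) = c * l w := linearZ_LR l c w.
have lE (v : V) (c : k) : l (v, c) = l (v, 0) + c.
  have -> : (v, c) = (v, 0) + c *: ((0, 1) : VK) :> VK.
    congr pair; last exact/esym/(etrans (add0r _))/mulr1.
    rewrite -[LHS]addr0; congr (_ + _); exact/esym/(@scaler0 k (restrict_scalars cst V)).
  rewrite raddfD; congr (_ + _).
  exact: (etrans (lZ _ _) (etrans (congr1 _ l1) (mulr1 _))).
exists (fun v : V => - l (v, 0)).
  split=> [a b|c a].
    rewrite -opprD -raddfD; congr (- l _); congr pair; exact/esym/addr0.
  rewrite mulrN; congr (- _); rewrite -[RHS]lZ; congr (l _); congr pair; exact/esym/mulr0.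
move=> v c Gvc; have := lG (v, c) Gvc; rewrite lE.
by move=> /eqP; rewrite addr_eq0 => /eqP ->; rewrite opprK.
Qed.

(* Hom_S(V, S) = Hom_Q(V, Q) for Q = k[y], by self-duality of S = Q + xQ. *)
Lemma x_coinduction (V : lmodType S) (phi : V -> S) :
  (forall a b, phi (a + b) = phi a + phi b) ->
  (forall c a, phi (cst c *: a) = cst c * phi a) ->
  (forall j a, phi (y j *: a) = y j * phi a) ->
  exists F : {linear V -> S^o}, forall a, F a = phi (x *: a) + x * phi a.
Proof.
move=> phiD phiC phiY; pose F (a : V) : S^o := phi (x *: a) + x * phi a.
have FD a b : F (a + b) = F a + F b by rewrite /F scalerDr !phiD mulrDr addrACA.
have FZ s a : F (s *: a) = s * F a.
  (* It suffices to check ring generators. For x, the equality x^2 = 0 reduces both sides to x phi(x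
     a). *)
  elim/S_ind: s a => [c|||s t Fs Ft|s t Fs Ft] => [a||j|a|a].
  - by rewrite /F scalerA [x * _]mulrC -scalerA !phiC mulrDr mulrCA.
  - move=> a; rewrite /F scalerA S_xx scale0r mulrDr [x * (x * _)]mulrA S_xx mul0r addr0.
    by rewrite -(scale0r 0) -(rmorph0 cst) phiC rmorph0 mul0r add0r.
  - move=> a; by rewrite /F scalerA [x * _]mulrC -scalerA !phiY mulrDr mulrCA.
  - by rewrite scalerDl FD Fs Ft mulrDl.
  - by rewrite -scalerA Fs Ft mulrA.
have F_linear : linear F by move=> c a b; rewrite FD FZ.
pose FL := GRing.isLinear.Build S V S^o *:%R F F_linear.
by exists (HB.pack F FL : {linear V -> S^o}).
Qed.

End ModulesOverS.

(** * Freeness over k[y] *)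

Section KernelSummand.
Variables (R : comNzRingType) (M : lmodType R) (F : {linear M -> R^o}).

Definition kernel_pred : {pred M} := fun u => F u == 0.

Lemma kernel_submod_closed : submod_closed kernel_pred.
Proof.
split=> [|c u v]; rewrite /kernel_pred !unfold_in ?raddf0 // => /eqP Fu /eqP Fv.
by rewrite linearP Fu Fv scaler0 addr0.
Qed.

HB.instance Definition _ :=
  GRing.isSubmodClosed.Build R M kernel_pred kernel_submod_closed.

Record kernel := Kernel { kernel_val : M; _ : kernel_val \in kernel_pred }.

HB.instance Definition _ := [isSub for kernel_val].
HB.instance Definition _ := [Choice of kernel by <:].
HB.instance Definition _ := [SubChoice_isSubLmodule of kernel by <:].

(** Such a form splits M as R u plus its kernel, by v = F(v) u + (v - F(v) u). *)
Lemma free_summand u : F u = 1 ->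
  exists (N : lmodType R) (f : {linear (R^o * N)%type -> M}), bijective f.
Proof.
move=> Fu; pose f (rn : (R^o * kernel)%type) : M := (rn.1 : R) *: u + val rn.2.
have f_linear : linear f.
  by move=> c [r v] [s w]; rewrite /f /= scalerDl scalerDr -scalerA addrACA.
pose fL := GRing.isLinear.Build R (R^o * kernel)%type M *:%R f f_linear.
exists kernel, (HB.pack f fL : {linear (R^o * kernel)%type -> M}).
have FZ (c : R) : F (c *: u) = c by rewrite linearZ_LR Fu [_ *: _]mulr1.
have FK v : v - (F v : R) *: u \in kernel_pred.
  by rewrite unfold_in /kernel_pred linearB FZ subrr.
exists (fun v => (F v, Kernel (FK v))) => [[r [v vK]]|v] /=; last first.
  by rewrite /f /= addrC subrK.
have Ff : F (f (r, Kernel vK)) = r.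
  rewrite /f /= linearD FZ.
  by move: vK; rewrite unfold_in => /eqP ->; rewrite addr0.
congr pair => //; apply: val_inj; rewrite /= Ff /f /= addrC addKr //.
Qed.

End KernelSummand.

Section YFree.
Variables (k : fieldType) (i : nat).
Local Notation S := (Sring k i).
Local Notation cst := (@S_const k i).
Local Notation x := (S_x k i).
Local Notation y := (@S_y k i).

Lemma y_delta (V : lmodType S) j (v : V) :
  y j *: v = \sum_l y l *: (if l == j then v else 0).
Proof.
rewrite (bigD1 j) //= eqxx big1 ?addr0 // => l /negPf ->; exact: scaler0.
Qed.

(* If z = d0 p violates the conclusion, some k-linear form kills y (ker d0) and is
   1 at y_j p.  Multiplied by y_l with l != j, it coinduces to a cocycle that is
   not a coboundary, since g (y_j p) = y_j (g p) has no component x y_l. *)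
Lemma syzygy_socle (hi : (2 <= i)%N) (T : lmodType S) (P : projective_resolution T) :
  y_free (res_mod P 1) ->
  (forall f : {linear res_mod P 2 -> S^o},
    (forall u, f (res_diff P 2 u) = 0) ->
    exists g : {linear res_mod P 1 -> S^o}, forall u, f u = g (res_diff P 1 u)) ->
  forall z, res_aug P z = 0 -> (forall j, y j *: z = 0) ->
  exists2 w : 'I_i -> res_mod P 0, (forall j, res_aug P (w j) = 0) &
    z = \sum_j y j *: w j.
Proof.
move=> free1 ext z /res_exact0[p pz] yz; apply: contrapT => nz.
(* The two distinct indices 0 and 1 exist because i is at least 2. *)
pose j := Ordinal (ltn_trans (ltnSn 0) hi); pose l := Ordinal hi.
have lj : l != j by [].
pose d0 := res_diff P 0; pose d1 := res_diff P 1.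
pose W (v : res_mod P 1) := exists2 w : 'I_i -> res_mod P 1,
  (forall j, d0 (w j) = 0) & v = \sum_j y j *: w j.
have Wy a v : d0 v = 0 -> W (y a *: v).
  move=> v0; exists (fun l => if l == a then v else 0); last exact: y_delta.
  by move=> b; case: eqP => // _; rewrite linear0.
have W0 : W 0.
  exists (fun=> 0) => [b|]; first by rewrite linear0.
  by rewrite big1 // => b _; rewrite scaler0.
have WD a b : W a -> W b -> W (a + b).
  move=> [w w0 ->] [w' w'0 ->]; exists (fun j => w j + w' j).
    by move=> c; rewrite linearD w0 w'0 addr0.
  by rewrite -big_split; apply: eq_bigr => c _; rewrite scalerDr.
have WZ c a : W a -> W (cst c *: a).
  move=> [w w0 ->]; exists (fun j => cst c *: w j).
    by move=> b; rewrite linearZ_LR w0 scaler0.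
  by rewrite scaler_sumr; apply: eq_bigr => b _; rewrite !scalerA mulrC.
(* If y_j p were a sum of y_a w_a with w_a in ker d0, freeness of P_1 would put p - w_j in y P_1.
   Applying d0 would then put z in y times the first syzygy. *)
have Wp : ~ W (y j *: p).
  move=> [w w0 pE]; have [|u uE] := free1 (fun l => (if l == j then p else 0) - w l) _ j.
    under eq_bigr do rewrite scalerBr.
    by rewrite sumrB -y_delta pE subrr.
  apply: nz; exists (fun l => d0 (u l)).
    by move=> a; apply/res_exact0; exists (u a).
  have <- : d0 (p - w j) = z by rewrite linearB w0 subr0.
  rewrite eqxx in uE; rewrite uE linear_sum; apply: eq_bigr => a _; exact: linearZ_LR.
have [lam [[lamD lamC] lamp lamW]] := k_separation W0 WD WZ Wp.
have d01 u : d0 (d1 u) = 0 by apply/res_exact; exists u.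
(* Compatibility with y_b holds because both sides vanish: [lam] kills y (ker d0), and y_b y_l =
   0. *)
have [||b u|f fE] := @x_coinduction k i (res_mod P 2) (fun u => cst (lam (d1 u)) * y l).
- by move=> a b; rewrite linearD lamD rmorphD mulrDl.
- by move=> c a; rewrite linearZ_LR lamC rmorphM mulrA.
- by rewrite mulrCA S_yy mulr0 linearZ_LR lamW ?rmorph0 ?mul0r //; apply: Wy.
have [|g gE] := ext f.
  move=> u; rewrite fE !(linearZ_LR, linear0) /= -/d1.
  have -> : d1 (res_diff P 2 u) = 0 by apply/res_exact; exists u.
  by rewrite scaler0 (k_linear0 (conj lamD lamC)) rmorph0 mul0r mulr0 addr0.
(* Since y_j z = 0, the element y_j p is a cycle and lifts to P_2. *)
have [q qE] : exists q, d1 q = y j *: p.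
  by apply/res_exact; rewrite linearZ_LR /= -/d0 [d0 p]pz yz.
(* The left side is a constant times y_l, plus x y_l; the right side is a multiple of y_j. *)
have := gE q; rewrite fE -/d1 qE lamp rmorph1 mul1r (linearZ_LR g).
exact: (S_xy_indep lj).
Qed.

(** Lifting a relation to P_0 gives a socle element of the first syzygy, which is a sum of y_j w_j
    with w_j in that syzygy. Freeness of P_0 puts p_j - w_j in y P_0, and the augmentation sends
    this difference to t_j. *)
Lemma Ext2_y_free (hi : (2 <= i)%N) (T : lmodType S) :
  Ext_succ_eq0 1 T S^o -> y_free T.
Proof.
move=> ext t t0 j.
pose P := free_resolution T; pose P0 := res_mod P 0.
have free0 : y_free P0 by exact: y_free_free_mod.
have free1 : y_free (res_mod P 1) by exact: y_free_free_mod.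
have [p pE] := choice (fun j => res_aug_surj P (t j)).
have augE : res_aug P (\sum_j y j *: p j) = 0.
  by rewrite linear_sum -[RHS]t0; apply: eq_bigr => l _; rewrite linearZ_LR /= pE.
have [l|w w0 wE] := syzygy_socle hi free1 (ext P) augE.
  by rewrite scaler_sumr big1 // => a _; rewrite scalerA S_yy scale0r.
have [|u uE] := free0 (fun j => p j - w j) _ j.
  under eq_bigr do rewrite scalerBr.
  by rewrite sumrB wE subrr.
exists (fun l => res_aug P (u l)).
rewrite -pE -[LHS]subr0 -[in LHS](w0 j) -linearB uE linear_sum.
by apply: eq_bigr => a _; rewrite linearZ_LR.
Qed.

Lemma S_unit_decomp (c : k) (d : 'I_i -> k) s : c != 0 ->
  exists r, r * (qelt c d + x * s) = 1.
Proof.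
move=> c0; pose q := qelt c^-1 (fun j => - (c^-1 * d j * c^-1)).
have qE : q * qelt c d = 1.
  rewrite qeltM mulVf // (_ : (fun j => _) = fun=> 0).
    by rewrite /qelt rmorph1 big1 ?addr0 // => j _; rewrite rmorph0 mul0r.
  by apply/funext => j; rewrite mulrN [c * _]mulrC divfK // subrr.
exists (q - x * (q * s * q)).
rewrite -mulrN S_xmul qE mulNr -[_ * q * qelt c d]mulrA qE mulr1 subrr mulr0 addr0 //.
Qed.

Lemma x_in_yM (T : lmodType S) : y_free T -> no_free_summand T ->
  forall u : T, in_yM (x *: u).
Proof.
move=> yT nofree u; apply: contrapT => xu; apply: nofree.
have Y0 : in_yM (0 : T) by exists (fun=> 0); rewrite big1 // => j _; rewrite scaler0.
have YD (a b : T) : in_yM a -> in_yM b -> in_yM (a + b).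
  move=> [v ->] [w ->]; exists (fun j => v j + w j).
  by rewrite -big_split; apply: eq_bigr => j _; rewrite scalerDr.
have YZ c (a : T) : in_yM a -> in_yM (cst c *: a).
  move=> [v ->]; exists (fun j => cst c *: v j).
  by rewrite scaler_sumr; apply: eq_bigr => j _; rewrite !scalerA mulrC.
have [lam [lamL lamxu lamY]] := k_separation Y0 YD YZ xu.
have [lamD lamC] := lamL.
(* This is the y_l-coefficient of the Q-linear form to be built. Compatibility with y forces its
   values on yT; they are well defined because T is y-free and [lam] kills yT, and they extend
   k-linearly to T. *)
have mu_ex l : exists2 mu : T -> k, k_linear mu &
    forall t : 'I_i -> T, mu (\sum_j y j *: t j) = lam (t l).
  pose G (v : T) c := exists2 t : 'I_i -> T, v = \sum_j y j *: t j & c = lam (t l).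
  have [||||mu muL muG] := @k_extension k i T G.
  - exists (fun=> 0); last by rewrite (k_linear0 lamL).
    by rewrite big1 // => j _; rewrite scaler0.
  - move=> a b c d [v -> ->] [w -> ->]; exists (fun j => v j + w j); last by rewrite lamD.
    by rewrite -big_split; apply: eq_bigr => j _; rewrite scalerDr.
  - move=> e a c [v -> ->]; exists (fun j => cst e *: v j); last by rewrite lamC.
    by rewrite scaler_sumr; apply: eq_bigr => j _; rewrite !scalerA mulrC.
  - by move=> c [t /esym t0 ->]; apply/lamY/yT.
  by exists mu => // t; apply: muG; exists t.
have [mu muP] := choice (fun l =>
  let: ex_intro2 m a b := mu_ex l in ex_intro _ m (conj a b)).
pose phi v := qelt (lam v) (fun l => mu l v) : S.
have phiD a b : phi (a + b) = phi a + phi b.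
  rewrite -qeltD /phi lamD; congr qelt; apply/funext => l.
  by have [[-> _] _] := muP l.
have phiC c a : phi (cst c *: a) = cst c * phi a.
  rewrite /phi /qelt lamC rmorphM mulrDr mulr_sumr; congr (_ + _).
  by apply: eq_bigr => l _; have [[_ ->] _] := muP l; rewrite rmorphM mulrA.
have phiY j a : phi (y j *: a) = y j * phi a.
  have := S_y_mul j (lam a) (fun l => mu l a) 0 (fun=> 0).
  rewrite (_ : qelt 0 _ = 0) ?mulr0 ?rmorph0 ?mul0r ?mulr0 ?addr0 => [|]; last first.
    by rewrite qelt0 big1 // => l _; rewrite rmorph0 mul0r.
  rewrite -/(phi a) => ->; rewrite /phi lamY ?qelt0; last first.
    by eexists; apply: y_delta.
  rewrite (bigD1 j) //= big1 ?addr0 => [|l lj].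
    by rewrite y_delta; have [_ ->] := muP j; rewrite eqxx.
  rewrite y_delta; have [_ ->] := muP l.
  by rewrite (negPf lj) (k_linear0 lamL) rmorph0 mul0r.
have [F FE] := x_coinduction phiD phiC phiY.
(* The value of F at u has constant term lam(x u) = 1, so it is a unit and u can be rescaled to
   value 1. *)
have [|r rE] := @S_unit_decomp 1 (fun l => mu l (x *: u)) (phi u); first exact: oner_neq0.
apply: (@free_summand S T F (r *: u)).
by rewrite linearZ_LR /= FE /phi lamxu.
Qed.

End YFree.

(** * The presentation *)

Section Presentation.
Variables (k : fieldType) (i : nat).
Local Notation S := (Sring k i).
Local Notation cst := (@S_const k i).
Local Notation x := (S_x k i).
Local Notation y := (@S_y k i).

Definition linear_pencil n (B : 'I_i -> 'M[k]_n) : 'M[S]_n :=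
  x *: 1%:M + \sum_(j < i) y j *: map_mx cst (B j).

Lemma linear_pencilE n (B : 'I_i -> 'M[k]_n) a b :
  linear_pencil B a b = x * (a == b)%:R + \sum_j cst (B j a b) * y j.
Proof.
rewrite /linear_pencil mxE mxE mxE summxE; congr (_ + _).
by apply: eq_bigr => j _; rewrite !mxE mulrC.
Qed.

Lemma qelt_mul_yspan c (d e : 'I_i -> k) :
  qelt c d * (\sum_j cst (e j) * y j) = qelt 0 (fun j => c * e j).
Proof.
rewrite -qelt0 qeltM mulr0; congr qelt.
by apply/funext => j; rewrite mul0r addr0.
Qed.

Lemma qelt_sum (I : finType) (c : I -> k) (d : I -> 'I_i -> k) :
  \sum_a qelt (c a) (d a) = qelt (\sum_a c a) (fun j => \sum_a d a j) :> S.
Proof.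
rewrite /qelt big_split /= rmorph_sum exchange_big /=; congr (_ + _).
by apply: eq_bigr => j _; rewrite rmorph_sum mulr_suml.
Qed.

Lemma linear_pencil_mul n (B : 'I_i -> 'M[k]_n) (v : 'I_n -> S) a :
  (\sum_b v b *: col b (linear_pencil B)) a 0 =
  x * v a + \sum_b v b * \sum_j cst (B j a b) * y j.
Proof.
rewrite summxE; under eq_bigr do rewrite 2!mxE linear_pencilE mulrDr.
rewrite big_split (bigD1 a) //= eqxx mulr1 mulrC big1 ?addr0 // => b /negPf ba.
by rewrite eq_sym ba !mulr0.
Qed.

(** In row a of the relation, the coefficient of x is the constant term of v_a, all other
    contributions being multiples of the y's. So the columns satisfy no relation with a unit
    coefficient. *)
Lemma linear_pencil_ker n (B : 'I_i -> 'M[k]_n) (v : 'I_n -> S) (e : {rmorphism S -> k}) :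
  (forall c d c' d', e (qelt c d + x * qelt c' d') = c) ->
  \sum_b v b *: col b (linear_pencil B) = 0 -> forall a, e (v a) = 0.
Proof.
move=> eE v0 a; have /matrixP/(_ a 0) := v0; rewrite linear_pencil_mul mxE.
have [c /choice[d /choice[c' /choice[d' vE]]]] := choice (fun a => S_decomp (v a)).
under eq_bigr do rewrite {1}vE mulrDl -mulrA !qelt_mul_yspan.
rewrite big_split /= -mulr_sumr !qelt_sum !big1 // {1}vE mulrDr mulrA S_xx mul0r addr0.
rewrite addrCA -mulrDr -qeltD addr0 => /qelt_inj0[_ _ ca _].
by rewrite vE eE.
Qed.

Lemma in_yMP (V : lmodType S) (n : nat) (g : 'I_n -> V) :
  generates (fun=> True) g ->
  forall v, in_yM v -> exists s : 'I_i -> 'I_n -> S,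
    v = \sum_j y j *: \sum_a s j a *: g a.
Proof.
move=> gen v [w ->]; have [s sE] := choice (fun j => (gen (w j)).1 I).
by exists s; apply: eq_bigr => j _; rewrite -sE.
Qed.

(* Nakayama, made explicit by (1 + s) (1 - s) = 1 for s in (y). *)
Lemma minimal_generators_mod_y (V : lmodType S) n (g : 'I_n -> V) (c : 'I_n -> k) :
  minimal_generators (fun=> True) g ->
  in_yM (\sum_a cst (c a) *: g a) -> forall a, c a = 0.
Proof.
case: n g c => [|n] g c [gen min] cy b; first by case: b.
have [//|cb0] := eqVneq (c b) 0.
have [s sE] := in_yMP gen cy.
suff /min : generates (fun=> True) (g \o lift b) by rewrite ltnn.
pose span v := exists u : 'I_n -> S, v = \sum_a u a *: g (lift b a).
have spanD v w : span v -> span w -> span (v + w).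
  move=> [u ->] [u' ->]; exists (fun a => u a + u' a).
  by rewrite -big_split; apply: eq_bigr => a _; rewrite scalerDl.
have spanZ r v : span v -> span (r *: v).
  move=> [u ->]; exists (fun a => r * u a).
  by rewrite scaler_sumr; apply: eq_bigr => a _; rewrite scalerA.
have lift_sum (u : 'I_n.+1 -> S) :
    \sum_a u a *: g a = u b *: g b + \sum_a u (lift b a) *: g (lift b a).
  by rewrite (bigD1_ord b).
have gb : span (g b).
  (* Solving the relation for [g b] leaves the factor 1 - m on the left, with m in (y) and hence m^2
     = 0. *)
  pose m := cst (c b)^-1 * \sum_j y j * s j b.
  have mm : m * m = 0 by rewrite mulrACA S_yspan_sqr mulr0.
  have gE : span ((1 - m) *: g b).
    have -> : (1 - m) *: g b = cst (c b)^-1 *: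
        (\sum_a (\sum_j y j * s j (lift b a)) *: g (lift b a) -
         \sum_a cst (c (lift b a)) *: g (lift b a)).
      have -> : \sum_a (\sum_j y j * s j (lift b a)) *: g (lift b a) =
          \sum_a cst (c a) *: g a - (\sum_j y j * s j b) *: g b.
        rewrite sE; apply/eqP; rewrite eq_sym subr_eq addrC; apply/eqP.
        rewrite -(lift_sum (fun a => \sum_j y j * s j a)).
        under eq_bigr do rewrite scaler_sumr.
        rewrite exchange_big; apply: eq_bigr => a _ /=; rewrite scaler_suml.
        by apply: eq_bigr => j _; rewrite scalerA.
      rewrite (lift_sum (fun a => cst (c a))) addrAC addrK scalerBr scalerA -rmorphM.
      by rewrite mulVf // rmorph1 scalerBl !scalerA.
    apply: (spanZ _ _); apply: (spanD _ _); first by eexists.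
    by rewrite -scaleN1r; apply: (spanZ _ _); eexists.
  rewrite (_ : g b = (1 + m) *: ((1 - m) *: g b)); first exact: spanZ.
  by rewrite scalerA mulrDl mul1r mulrBr mulr1 mm subr0 subrK scale1r.
move=> v; split=> // _; have [u ->] := (gen v).1 I.
by rewrite lift_sum; apply: (spanD _ _); [apply: (spanZ _ _)|eexists].
Qed.

(** * Relations among minimal generators when T is free over k[y] and xT lies in yT *)

Section MinimalGenerators.
Variables (T : lmodType S) (n : nat) (g : 'I_n -> T).
Hypotheses (T_free : y_free T) (xT : forall u : T, in_yM (x *: u)).
Hypothesis g_min : minimal_generators (fun=> True) g.

(** Minimality modulo yT kills the constants c; freeness then puts each y_j-component in yT, where
    minimality kills d as well. *)
Lemma y_basis (c : 'I_n -> k) (d : 'I_n -> 'I_i -> k) :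
  \sum_a qelt (c a) (d a) *: g a = 0 -> forall a, c a = 0 /\ forall j, d a j = 0.
Proof.
have split_sum : \sum_a qelt (c a) (d a) *: g a = \sum_a cst (c a) *: g a +
    \sum_j y j *: \sum_a cst (d a j) *: g a.
  under [X in _ = _ + X]eq_bigr do rewrite scaler_sumr.
  rewrite exchange_big -big_split; apply: eq_bigr => a _ /=.
  rewrite scalerDl scaler_suml; congr (_ + _); apply: eq_bigr => j _.
  by rewrite scalerA mulrC.
rewrite split_sum => /eqP; rewrite addr_eq0 => /eqP cE.
have c0 : forall a, c a = 0.
  apply: (minimal_generators_mod_y g_min); rewrite cE.
  exists (fun j => - \sum_a cst (d a j) *: g a).
  by rewrite -sumrN; apply: eq_bigr => j _; rewrite scalerN.
move=> a; split=> // j.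
apply: (minimal_generators_mod_y g_min (c := d^~ j)).
apply: (T_free (t := fun j => \sum_a cst (d a j) *: g a)).
apply: oppr_inj; rewrite -cE oppr0 big1 // => b _.
by rewrite c0 rmorph0 scale0r.
Qed.

Lemma x_action : exists B : 'I_i -> 'M[k]_n, forall b,
  \sum_a linear_pencil B a b *: g a = 0.
Proof.
have yx j (u : T) : y j *: (x *: u) = 0.
  have [w ->] := xT u; rewrite scaler_sumr big1 // => l _.
  by rewrite scalerA S_yy scale0r.
have xg b : exists C : 'I_i -> 'I_n -> k,
    x *: g b = \sum_j y j *: \sum_a cst (C j a) *: g a.
  have [s ->] := in_yMP g_min.1 (xT (g b)).
  (* Only the constant term of a coefficient survives multiplication by y_j: its y-part is killed by
     y_j, and its x-part by y_j x T = 0. *)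
  have /choice[C CE] : forall ja : 'I_i * 'I_n, exists c,
      y ja.1 *: (s ja.1 ja.2 *: g ja.2) = y ja.1 *: (cst c *: g ja.2).
    case=> j a /=; have [c [d [c' [d' ->]]]] := S_decomp (s j a); exists c.
    rewrite !scalerA S_y_mul scalerDl [y j * _]mulrC -[RHS]addr0; congr (_ + _).
    by rewrite mulrCA -scalerA mulrC -scalerA yx scaler0.
  exists (fun j a => C (j, a)); apply: eq_bigr => j _; rewrite !scaler_sumr.
  by apply: eq_bigr => a _; apply: (CE (j, a)).
have [C CE] := choice xg.
(* The sign turns the expansion of x g_b into a relation, recorded by column b. *)
exists (fun j => \matrix_(a, b) - C b j a) => b.
under eq_bigr do rewrite linear_pencilE scalerDl.
rewrite big_split (bigD1 b) //= eqxx mulr1 big1 ?addr0 => [|a ab]; last first.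
  by rewrite (negPf ab) mulr0 scale0r.
rewrite CE; apply/eqP; rewrite addr_eq0; apply/eqP.
under [LHS]eq_bigr do rewrite scaler_sumr.
rewrite exchange_big -sumrN; apply: eq_bigr => a _ /=.
rewrite scaler_suml -sumrN; apply: eq_bigr => j _.
by rewrite mxE rmorphN mulNr scaleNr opprK scalerA mulrC.
Qed.

Lemma linear_pencil_presentation : exists B : 'I_i -> 'M[k]_n,
  presentation_matrix T (linear_pencil B).
Proof.
have [B B0] := x_action; exists B.
pose eps (v : 'cV[S]_n) : T := \sum_a v a 0 *: g a.
have eps_linear : linear eps.
  move=> c u v; rewrite /eps scaler_sumr -big_split; apply: eq_bigr => a _ /=.
  by rewrite !mxE scalerDl scalerA.
pose epsL := GRing.isLinear.Build S 'cV[S]_n T *:%R eps eps_linear.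
pose epsl : {linear 'cV[S]_n -> T} := HB.pack eps epsL.
exists epsl; split.
  rewrite (_ : (fun a => _) = g) //; apply/funext => a.
  rewrite /epsl /= /eps (bigD1 a) //= mxE !eqxx scale1r big1 ?addr0 // => b ba.
  by rewrite mxE (negPf ba) scale0r.
have eps_col c : eps (\sum_b c b *: col b (linear_pencil B)) = 0.
  rewrite -[eps]/(epsl : _ -> _) linear_sum big1 // => b _; rewrite linearZ_LR.
  rewrite [epsl _](_ : _ = 0) ?scaler0 // -[RHS](B0 b).
  by apply: eq_bigr => a _; rewrite mxE.
have gen : generates (fun v => epsl v = 0) (fun b => col b (linear_pencil B)).
  move=> v; split=> [v0|[c ->]]; last exact: eps_col.
  have [c /choice[d /choice[c' /choice[d' vE]]]] := choice (fun a => S_decomp (v a 0)).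
  (* Subtracting these multiples of the columns cancels the x-part of v, so w has entries in Q and
     vanishes by [y_basis]. *)
  pose r a := qelt (c' a) (d' a) : S; exists r.
  pose w := v - \sum_b r b *: col b (linear_pencil B).
  suff w0 : w = 0 by apply/eqP; rewrite -subr_eq0 -/w w0.
  have wE a : w a 0 = qelt (c a) (fun j => d a j - \sum_b c' b * B j a b).
    rewrite [LHS]mxE vE [X in _ + X]mxE linear_pencil_mul opprD addrA addrK.
    under eq_bigr do rewrite /r qelt_mul_yspan.
    by rewrite qelt_sum big1 // -qeltB subr0.
  have /y_basis wb :
      \sum_a qelt (c a) (fun j => d a j - \sum_b c' b * B j a b) *: g a = 0.
    under eq_bigr do rewrite -wE.
    by rewrite -[LHS]/(epsl w) linearB v0 [epsl (\sum_b _)]eps_col subrr.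
  apply/matrixP => a b; rewrite ord1 wE mxE; have [ca da] := wb a.
  by rewrite /qelt ca rmorph0 add0r big1 // => j _; rewrite da rmorph0 mul0r.
split=> // p h genh; have [e eE] := S_augmentation k i.
have colK b : epsl (col b (linear_pencil B)) = 0.
  by rewrite -[RHS](B0 b); apply: eq_bigr => a _; rewrite mxE.
(* The columns and h are expressed through each other. Modulo the maximal ideal the product of the
   two coefficient matrices is the identity of size n, by [linear_pencil_ker], whence n is at most
   p. *)
have /choice[s sE] b := (genh _).1 (colK b).
have hK a : epsl (h a) = 0.
  apply/genh; exists (fun b => (b == a)%:R).
  rewrite (bigD1 a) //= eqxx scale1r big1 ?addr0 // => b /negPf ->; exact: scale0r.
have /choice[r rE] a := (gen _).1 (hK a).
apply: (@mulmx1_min k n p (\matrix_(b, a) e (s b a)) (\matrix_(a, b) e (r a b))).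
apply/matrixP => b b'; rewrite !mxE.
under eq_bigr do rewrite !mxE -rmorphM.
rewrite -rmorph_sum; apply/eqP; rewrite -subr_eq0 -(rmorph_nat e) -rmorphB; apply/eqP.
apply: (linear_pencil_ker (B := B) (v := fun b' =>
  \sum_a s b a * r a b' - (b == b')%:R) eE).
under eq_bigr do rewrite scalerBl scaler_suml.
rewrite sumrB exchange_big /= [X in _ - X](bigD1 b) //= eqxx scale1r.
rewrite [X in _ - (_ + X)]big1 => [|c /negPf cb]; last by rewrite eq_sym cb scale0r.
apply/eqP; rewrite addr0 subr_eq0 [X in _ == X]sE; apply/eqP/eq_bigr => a _.
by rewrite rE scaler_sumr; apply: eq_bigr => c _; rewrite scalerA.
Qed.


End MinimalGenerators.
End Presentation.

(* The hypothesis [no_free_summand T] is needed: a nonzero free module is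
   totally reflexive, but its presentation matrices have no columns. *)
Theorem theorem3p2 (k : fieldType) (hk : [pchar k] =i pred0)
    (i : nat) (hi : (2 <= i)%N) (T : lmodType (Sring k i)) (n : nat)
    (hT : totally_reflexive T) (hfree : no_free_summand T)
    (hn : minimally_generated T n) :
  exists B : 'I_i -> 'M[k]_n,
    presentation_matrix T
      (S_x k i *: (1%:M : 'M[Sring k i]_n)
       + \sum_(j < i) S_y k j *: map_mx (@S_const k i) (B j)).
Proof.
(* The index of [Ext_succ_eq0] is shifted by one: index 1 is Ext^2. *)
have [_ /(_ 1) extT _ _] := hT; have [g g_min] := hn.
have T_free := Ext2_y_free hi extT.
exact: linear_pencil_presentation T_free (x_in_yM T_free hfree) g_min.
Qed.
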